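(* Let $n\in\mathbb{N}$ be even. Then $$Q_nQ_n\subset Q_n,\qquad P_nP_n\subset Q_n,\qquad P_nQ_n\subset P_n,\qquad Q_nP_n\subset P_n.$$
   Context: Let $n=2\nu$; matrix indices are taken in $\mathbb{Z}_n=\mathbb{Z}/n\mathbb{Z}$ (computed modulo $n$). $P_n$ is the space of matrices $M\in\mathbb{R}^{n\times n}$ with $M_{i,j}+M_{i+\nu,j+\nu}=0$ for all $i,j\in\mathbb{Z}_n$; $Q_n$ is the space of matrices $M\in\mathbb{R}^{n\times n}$ with $M_{i,j}-M_{i+\nu,j+\nu}=0$ for all $i,j\in\mathbb{Z}_n$. For sets of matrices $X,Y$, $XY$ denotes the set of matrix products $xy$ with $x\in X$, $y\in Y$. *)

(* Defs.v *)
From HB Require Import structures.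
From mathcomp Require Import all_boot all_order all_algebra.
From mathcomp Require Import classical_sets reals.

Set Implicit Arguments.
Unset Strict Implicit.
Unset Printing Implicit Defensive.

Import Order.TTheory GRing.Theory Num.Theory.

Local Open Scope classical_set_scope.
Local Open Scope ring_scope.

(* 'I_n plays the role of Z/nZ. 'Z_n is avoided because it is Z/2Z for n < 2,
   and the additive structure of 'I_n requires n to be syntactically a
   successor. The bound 0 < n needed for the modulus comes from i itself. *)
Definition Zn_add (n : nat) (i : 'I_n) (k : nat) : 'I_n :=
  Ordinal (ltn_pmod (i + k) (leq_ltn_trans (leq0n i) (ltn_ord i))).

Definition Pn (R : realType) (n : nat) : set 'M[R]_n :=
  [set M | forall i j : 'I_n,
     M i j + M (Zn_add i n./2) (Zn_add j n./2) = 0].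
Arguments Pn : clear implicits.

Definition Qn (R : realType) (n : nat) : set 'M[R]_n :=
  [set M | forall i j : 'I_n,
     M i j - M (Zn_add i n./2) (Zn_add j n./2) = 0].
Arguments Qn : clear implicits.

Definition mxset_mul (R : realType) (n : nat) (X Y : set 'M[R]_n) :
    set 'M[R]_n :=
  [set x *m y | x in X & y in Y].

(* Main.v *)
(* M lies in Q_n, resp. P_n, iff simultaneously shifting rows and columns by nu
   multiplies M by the sign 1, resp. -1. As shifting permutes the summation
   index of a matrix product, the signs of the factors multiply. *)

Require Import Defs.
From HB Require Import structures.
From mathcomp Require Import all_boot all_order all_algebra.
From mathcomp Require Import classical_sets reals.

Set Implicit Arguments.
Unset Strict Implicit.
Unset Printing Implicit Defensive.

Import Order.TTheory GRing.Theory Num.Theory.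

Local Open Scope classical_set_scope.
Local Open Scope ring_scope.

(** Adding [k] cancels modulo [n], and indices below [n] equal their residues. On the finite type
    ['I_n] this suffices for reindexing sums. *)
Lemma Zn_add_inj (n k : nat) : injective (fun i : 'I_n => Zn_add i k).
Proof.
move=> i j /(congr1 val) /= /eqP; rewrite eqn_modDr !modn_small // => /eqP.
exact: val_inj.
Qed.

(** The factor [a] is a parameter so that one product lemma covers all four inclusions. *)
Definition shift_scaled (R : pzRingType) (n k : nat) (a : R) (M : 'M[R]_n) :=
  forall i j, M (Zn_add i k) (Zn_add j k) = a * M i j.

Lemma shift_scaled_mul (R : comPzRingType) (n k : nat) (a b : R)
    (M N : 'M[R]_n) :
  shift_scaled k a M -> shift_scaled k b N -> shift_scaled k (a * b) (M *m N).
Proof.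
(* Only the sum for the shifted entry is reindexed, by [l] to [Zn_add l k]; both factors then have
   shifted row and column. *)
move=> MP NP i j; rewrite !mxE (reindex_inj (@Zn_add_inj n k)) mulr_sumr.
by apply: eq_bigr => l _; rewrite MP NP mulrACA.
Qed.

Lemma QnP (R : realType) (n : nat) (M : 'M[R]_n) :
  Qn R n M <-> shift_scaled n./2 1 M.
Proof.
split=> MP i j; first by rewrite mul1r; apply/esym/subr0_eq/MP.
by rewrite MP mul1r subrr.
Qed.

Lemma PnP (R : realType) (n : nat) (M : 'M[R]_n) :
  Pn R n M <-> shift_scaled n./2 (-1) M.
Proof.
split=> MP i j; last by rewrite MP mulN1r subrr.
by rewrite mulN1r; apply/eqP; rewrite -addr_eq0 addrC; apply/eqP/MP.
Qed.

Theorem theorem4 (R : realType) (n : nat) (n_even : ~~ odd n) :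
  [/\ mxset_mul (Qn R n) (Qn R n) `<=` Qn R n,
      mxset_mul (Pn R n) (Pn R n) `<=` Qn R n,
      mxset_mul (Pn R n) (Qn R n) `<=` Pn R n
    & mxset_mul (Qn R n) (Pn R n) `<=` Pn R n].
Proof.
split=> _ [x xP [y yP <-]].
(* In each case the target sign is written as the product of the signs of the two factors. *)
- apply/QnP; rewrite -[1]mulr1.
  by apply: shift_scaled_mul; apply/QnP.
(* Here 1 becomes (-1) * (-1). *)
- apply/QnP; rewrite -[1]mulr1 -mulrNN.
  by apply: shift_scaled_mul; apply/PnP.
- apply/PnP; rewrite -[-1]mulr1.
  by apply: shift_scaled_mul; [apply/PnP | apply/QnP].
- apply/PnP; rewrite -[-1]mul1r.
  by apply: shift_scaled_mul; [apply/QnP | apply/PnP].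
Qed.
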